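(* Let $A=\{a_1,\dots,a_n\}$ be a set of positive integers (arbitrary; not required to be relatively prime), let $P_A(t)$ be the polynomial part of the restricted partition function $p_A(t)$, let $B_j$ denote the Bernoulli numbers, and let $s_i=a_1^i+\cdots+a_n^i$ for $i\ge 1$. Then $$P_A(t)=\frac{1}{a_1\cdots a_n}\sum_{m=0}^{n-1}\frac{(-1)^m}{(n-1-m)!}\sum_{k_1+\dots+k_n=m}a_1^{k_1}\cdots a_n^{k_n}\,\frac{B_{k_1}\cdots B_{k_n}}{k_1!\cdots k_n!}\,t^{n-1-m},$$ where the inner sum is over all $n$-tuples $(k_1,\dots,k_n)$ of nonnegative integers with $k_1+\dots+k_n=m$, and also $$P_A(t)=\frac{1}{a_1\cdots a_n}\sum_{m=0}^{n-1}\frac{(-1)^m}{(n-1-m)!}\sum_{k_1+2k_2+\dots+mk_m=m}\frac{(-1)^{k_2+\cdots+k_m}}{k_1!\cdots k_m!}\left(\frac{B_1s_1}{1\cdot 1!}\right)^{k_1}\cdots\left(\frac{B_ms_m}{m\cdot m!}\right)^{k_m}t^{n-1-m},$$ where the inner sum is over all $m$-tuples $(k_1,\dots,k_m)$ of nonnegative integers with $k_1+2k_2+\dots+mk_m=m$.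
   Context: For a nonnegative integer $t$, $p_A(t)$ is the number of $n$-tuples $(m_1,\dots,m_n)$ of nonnegative integers with $\sum_{j=1}^n m_ja_j=t$; equivalently, $p_A(t)$ is the coefficient of $z^t$ in $G(z)=\frac{1}{(1-z^{a_1})\cdots(1-z^{a_n})}$. By partial fractions, $p_A(t)$ can be written in the form $\sum_\lambda P_{A,\lambda}(t)\lambda^t$ (for all integers $t\ge 0$), where the sum is over all complex numbers $\lambda$ such that $\lambda^{a_i}=1$ for some $i$, and each $P_{A,\lambda}(t)$ is a polynomial in $t$ (with complex coefficients); these polynomials are uniquely determined. The polynomial part of $p_A(t)$ is $P_A(t):=P_{A,1}(t)$. The Bernoulli numbers $B_j$ are defined by $\frac{z}{e^z-1}=\sum_{j\ge 0}B_j\frac{z^j}{j!}$ (so $B_0=1$, $B_1=-\tfrac12$, $B_2=\tfrac16$, and $B_j=0$ for odd $j>1$). Conventions: $0^0=1$ (also for $t^0$), empty products equal $1$, empty sums equal $0$; in particular, for $m=0$ the inner sum of the second formula consists of the single empty tuple and equals $1$. *)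

(* Defs.v *)
From HB Require Import structures.
From mathcomp Require Import all_boot all_order all_algebra.
From mathcomp Require Import all_classical all_reals.
From mathcomp Require Import complex.

Set Implicit Arguments.
Unset Strict Implicit.
Unset Printing Implicit Defensive.

Import Order.TTheory GRing.Theory Num.Theory.
Local Open Scope classical_set_scope.
Local Open Scope ring_scope.

(* The finite set [set a j | j : 'I_n] of positive integers is given by an
   injective enumeration a : 'I_n -> nat. *)

(* The bound m_j <= t built into the type of m loses no solution of
   m_1 a_1 + ... + m_n a_n = t when all the a_j are positive. *)
Definition restricted_partition (n : nat) (a : 'I_n -> nat) (t : nat) : nat :=
  #|[set m : {ffun 'I_n -> 'I_t.+1} | (\sum_(j < n) m j * a j)%N == t]|.

(* The index set of the sum is finite when all the a_i are positive; only the
   values of P on that set matter. *)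
Definition is_partition_decomposition (C : numClosedFieldType) (n : nat)
    (a : 'I_n -> nat) (P : C -> {poly C}) : Prop :=
  forall t : nat,
    (restricted_partition a t)%:R =
    \sum_(l \in [set l : C | exists i : 'I_n, l ^+ a i = 1])
      (P l).[t%:R] * l ^+ t.

(* The component at 1 of a decomposition; the default value 0 is irrelevant for
   n > 0 and positive a_i, where a decomposition exists and is unique on the
   index set. *)
Definition polynomial_part (C : numClosedFieldType) (n : nat)
    (a : 'I_n -> nat) : {poly C} :=
  xget 0 [set Q : {poly C} |
    exists P : C -> {poly C}, is_partition_decomposition a P /\ P 1 = Q].

(* Formal power series are represented by their coefficient sequences. *)
Definition series_mul (F : fieldType) (u v : nat -> F) (n : nat) : F :=
  \sum_(k < n.+1) u k * v (n - k)%N.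

Definition exp_series_sub1 (F : fieldType) (n : nat) : F :=
  n`!%:R^-1 - (n == 0)%:R.

(* (\sum_j B_j z^j / j!) (e^z - 1) = z, i.e. the generating function of the
   B_j / j! is z / (e^z - 1). *)
Definition is_bernoulli_seq (F : fieldType) (B : nat -> F) : Prop :=
  forall n : nat,
    series_mul (fun j => B j / j`!%:R) (@exp_series_sub1 F) n = (n == 1)%:R.

Definition power_sum (n : nat) (a : 'I_n -> nat) (i : nat) : nat :=
  (\sum_(j < n) a j ^ i)%N.

Lemma exp_series_sub1_0 (F : fieldType) : exp_series_sub1 F 0 = 0.
Proof. by rewrite /exp_series_sub1 fact0 invr1 subrr. Qed.

Lemma exp_series_sub1_1 (F : fieldType) : exp_series_sub1 F 1 = 1.
Proof. by rewrite /exp_series_sub1 factS fact0 invr1 subr0. Qed.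

Lemma is_bernoulli_seq_rec (F : numFieldType) (B : nat -> F) :
  is_bernoulli_seq B <->
  forall n, B n = n`!%:R * ((n == 0)%:R
    - \sum_(k < n) B k / k`!%:R * exp_series_sub1 F (n.+1 - k)).
Proof.
have nz n : n`!%:R != 0 :> F by rewrite pnatr_eq0 -lt0n fact_gt0.
have E n : series_mul (fun j => B j / j`!%:R) (@exp_series_sub1 F) n.+1 =
    \sum_(k < n) B k / k`!%:R * exp_series_sub1 F (n.+1 - k) + B n / n`!%:R.
  rewrite /series_mul big_ord_recr /= subnn exp_series_sub1_0 mulr0 addr0.
  by rewrite big_ord_recr /= subSnn exp_series_sub1_1 mulr1.
split=> [h n|h [|n]].
- by rewrite -[(n == 0)]/(n.+1 == 1) -h E addrC addKr mulrC divfK.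
- by rewrite /series_mul big_ord1 exp_series_sub1_0 mulr0.
- by rewrite E [B n]h [n`!%:R * _]mulrC mulfK // addrC subrK.
Qed.

Lemma is_bernoulli_seq_exists (F : numFieldType) :
  exists B : nat -> F, is_bernoulli_seq B.
Proof.
pose step (s : seq F) := rcons s ((size s)`!%:R * ((size s == 0)%:R
  - \sum_(k < size s) s`_k / k`!%:R * exp_series_sub1 F ((size s).+1 - k))).
pose L n := iter n step [::].
have sz n : size (L n) = n by elim: n => //= n IH; rewrite size_rcons IH.
have stab n k : (k < n)%N -> (L n)`_k = (L k.+1)`_k.
  elim: n => // n IH; rewrite ltnS leq_eqVlt => /orP[/eqP -> //|kn].
  by rewrite -IH //= nth_rcons sz kn.
exists (fun n => (L n.+1)`_n); apply/is_bernoulli_seq_rec => n.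
rewrite /= nth_rcons sz ltnn eqxx; congr (_ * (_ - _)).
by apply: eq_bigr => k _; rewrite stab.
Qed.

Lemma is_bernoulli_seq_unique (F : numFieldType) (B B' : nat -> F) :
  is_bernoulli_seq B -> is_bernoulli_seq B' -> B =1 B'.
Proof.
move=> /is_bernoulli_seq_rec h /is_bernoulli_seq_rec h' n.
elim/ltn_ind: n => n IH; rewrite h h'; congr (_ * (_ - _)).
by apply: eq_bigr => k _; rewrite IH.
Qed.

(* Main.v *)
Require Import Defs.
From HB Require Import structures.
From mathcomp Require Import all_boot all_order all_algebra.
From mathcomp Require Import all_classical all_reals.
From mathcomp Require Import complex.
From mathcomp Require Import ring zify.

Set Implicit Arguments.
Unset Strict Implicit.
Unset Printing Implicit Defensive.

Import Order.TTheory GRing.Theory Num.Theory.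
Local Open Scope ring_scope.

(** Write Res for the coefficient of 1/z in a Laurent series at 0.  The idea is
    that the polynomial part of the partition function is

      Q(t) = Res exp (t z) / prod_j (1 - exp (- a_j z)),

    and that this can be checked without partial fractions.  Let E be the shift
    of sequences and apply W = prod_j (1 + E + ... + E ^ (a_j - 1)), whose roots
    are roots of unity other than 1, to both sequences.  On the generating
    function prod_j 1 / (1 - z ^ a_j), W acts, up to a shift by
    d = sum_j (a_j - 1), as multiplication by prod_j (1 - z ^ a_j) / (1 - z);
    so W p_A (t) is the coefficient of z ^ (t + d) in 1 / (1 - z) ^ n.  Under the
    residue E acts as multiplication by exp z; so W Q (t) is
    Res exp ((t + d) z) / (1 - exp (- z)) ^ n ([bernS_geometric]).  The two
    agree ([coef_exp_todd]); what makes this work is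
    Res 1 / (1 - exp (- z)) ^ m = 1 for all m > 0 ([coef_todd]), which holds
    because w = 1 / (1 - exp (- z)) satisfies w' = w - w ^ 2.

    Hence W kills p_A - Q, and solving the corresponding difference equations
    one root at a time shows that p_A - Q is a combination of terms
    P_l(t) l ^ t with l a root of unity other than 1 ([is_exp_poly_residue]).
    Since the coefficients of such combinations are unique ([exp_poly_eq0]), Q
    is the polynomial part ([polynomial_partE]).

    Since a z / (1 - exp (- a z)) is the Bernoulli series at - a z, the residue is
    a coefficient of a product of Bernoulli series and an exponential.  Expanding
    the product gives the first formula ([bern_prodE]).  The second one is the
    expansion of the exponential of the logarithm of the product
    ([bern_prod_logE]): the logarithmic derivative of b(z) = z / (exp z - 1) is
    given by z b' = (1 - z - b) b ([euler_bernS]), and power sums appear on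
    adding the contributions of the a_j. *)

(** * The ring of formal power series *)

Definition series (F : fieldType) : Type := nat -> F.

HB.instance Definition _ (F : fieldType) := Choice.copy (series F) (nat -> F).
HB.instance Definition _ (F : fieldType) :=
  GRing.Zmodule.copy (series F) (nat -> F).

Section SeriesRing.
Variable F : fieldType.
Implicit Types (u v w : series F) (n N : nat).

Definition series_one : series F := fun n => (n == 0)%:R.

(** The ring laws are inherited from those of polynomials: a coefficient of a
    product of series depends on finitely many coefficients of the factors,
    so it is a coefficient of a product of truncations. *)
Lemma series_mul_poly u v n N : (n < N)%N ->
  series_mul u v n = (\poly_(i < N) u i * \poly_(i < N) v i)`_n.
Proof.
move=> nN; rewrite coefM; apply: eq_bigr => i _; rewrite !coef_poly.
by rewrite (leq_ltn_trans (leq_ord i) nN) (leq_ltn_trans (leq_subr _ _) nN).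
Qed.

Lemma series_mulA u v w :
  series_mul u (series_mul v w) = series_mul (series_mul u v) w.
Proof.
apply/funext => n; set T := fun u => \poly_(i < n.+1) u i.
transitivity (T u * (T v * T w))`_n.
  rewrite coefM; apply: eq_bigr => i _; rewrite coef_poly ltn_ord.
  by rewrite (@series_mul_poly _ _ _ n.+1) // ltnS leq_subr.
rewrite mulrA coefM; apply: eq_bigr => i _.
by rewrite coef_poly ltnS leq_subr (@series_mul_poly _ _ _ n.+1).
Qed.

Lemma series_mulC : commutative (@series_mul F).
Proof.
by move=> u v; apply/funext => n; rewrite !(@series_mul_poly _ _ _ n.+1) // mulrC.
Qed.

Lemma series_mul1 : left_id series_one (@series_mul F).
Proof.
move=> u; apply/funext => n; rewrite /series_mul big_ord_recl mul1r subn0.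
by rewrite big1 ?addr0 // => i _; rewrite mul0r.
Qed.

Lemma series_mulDl : left_distributive (@series_mul F) (fun u v => u + v : series F).
Proof.
move=> u v w; apply/funext => n; rewrite /series_mul /GRing.add /= -big_split.
by apply: eq_bigr => i _; rewrite mulrDl.
Qed.

Lemma series_one_neq0 : series_one != 0 :> series F.
Proof.
by apply/eqP => /(congr1 (fun u : series F => u 0%N)) /eqP; rewrite oner_eq0.
Qed.

End SeriesRing.

HB.instance Definition _ (F : fieldType) :=
  GRing.Zmodule_isComNzRing.Build (series F) (@series_mulA F) (@series_mulC F)
    (@series_mul1 F) (@series_mulDl F) (@series_one_neq0 F).

Section SeriesCoef.
Variable F : fieldType.
Implicit Types (u v w : series F) (c d : F) (m n : nat).

Lemma coefsM u v n : (u * v) n = \sum_(k < n.+1) u k * v (n - k)%N.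
Proof. by []. Qed.

Lemma coefsD u v n : (u + v) n = u n + v n.
Proof. by []. Qed.

Lemma coefsN u n : (- u) n = - u n.
Proof. by []. Qed.

Lemma coefsB u v n : (u - v) n = u n - v n.
Proof. by []. Qed.

Lemma coefs1 n : (1 : series F) n = (n == 0)%:R.
Proof. by []. Qed.

Lemma coefs_sum (I : Type) (r : seq I) (P : pred I) (f : I -> series F) n :
  (\sum_(i <- r | P i) f i) n = \sum_(i <- r | P i) f i n.
Proof. by elim/big_rec2: _ => // i x y _ <-; rewrite coefsD. Qed.

Lemma coefsMn u k n : (u *+ k) n = u n *+ k.
Proof. by elim: k => // k IH; rewrite !mulrSr coefsD IH. Qed.

Lemma coefsM0 u v : (u * v) 0%N = u 0%N * v 0%N.
Proof. by rewrite coefsM big_ord1. Qed.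

Lemma coefs_prod0 (I : Type) (r : seq I) (P : pred I) (f : I -> series F) :
  (\prod_(i <- r | P i) f i) 0%N = \prod_(i <- r | P i) f i 0%N.
Proof. by elim/big_rec2: _ => // i x y _ <-; rewrite coefsM0. Qed.

Definition constS c : series F := fun n => if n is 0 then c else 0.

Lemma coefs_constM c u n : (constS c * u) n = c * u n.
Proof.
rewrite coefsM big_ord_recl subn0 big1 ?addr0 // => i _; exact: mul0r.
Qed.

Lemma constS1 : constS 1 = 1.
Proof. by apply/funext => -[]. Qed.

Lemma constSM c d : constS (c * d) = constS c * constS d.
Proof. by apply/funext => -[|n]; rewrite coefs_constM ?mulr0. Qed.

Lemma constS_prod (I : Type) (r : seq I) (P : pred I) (f : I -> F) :
  constS (\prod_(i <- r | P i) f i) = \prod_(i <- r | P i) constS (f i).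
Proof. by apply: (big_morph _ constSM constS1). Qed.

Definition varS : series F := fun n => (n == 1)%:R.

Lemma coefs_varM u n : (varS * u) n = if n is k.+1 then u k else 0.
Proof.
case: n => [|n]; first by rewrite coefsM big_ord1 mul0r.
rewrite coefsM big_ord_recl mul0r add0r big_ord_recl mul1r subn1 /=.
by rewrite big1 ?addr0 // => i _; rewrite mul0r.
Qed.

Lemma varS_inj u v : varS * u = varS * v -> u = v.
Proof.
by move=> e; apply/funext => n; move: (congr1 (fun u : series F => u n.+1) e);
  rewrite !coefs_varM.
Qed.

Lemma coefs_varXM u i n :
  (varS ^+ i * u) n = if (i <= n)%N then u (n - i)%N else 0.
Proof.
elim: i u n => [|i IH] u n; first by rewrite mul1r subn0.
by rewrite exprS -mulrA coefs_varM; case: n.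
Qed.

(** Substitution of the w-th power of the variable. *)
Definition dilate (w : nat) u : series F :=
  fun n => if (w %| n)%N then u (n %/ w)%N else 0.

(** Expanding the truncated factors multiplies out to a finite sum over the
    functions k.  With weights a_j this counts partitions; with weights 1 and
    i + 1 it produces the two families of Bernoulli sums. *)
Lemma coefs_prod_dilate (n m : nat) (w : 'I_n -> nat) (f : 'I_n -> series F) :
  (forall j, 0 < w j)%N ->
  (\prod_(j < n) dilate (w j) (f j)) m =
    \sum_(k : {ffun 'I_n -> 'I_m.+1} | (\sum_(j < n) w j * k j)%N == m)
      \prod_(j < n) f j (k j).
Proof.
move=> w_gt0.
pose trunc j : {poly F} := \sum_(k < m.+1) (f j k)%:P * 'X^(w j * k).
have truncE j i : (i <= m)%N -> dilate (w j) (f j) i = (trunc j)`_i.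
  move=> im; rewrite /dilate coef_sum.
  under eq_bigr => k _ do rewrite coefCM coefXn.
  case: ifPn => [/dvdnP[q ei]|ndv].
    have qm : (q < m.+1)%N.
      by rewrite ltnS (leq_trans _ im) // ei leq_pmulr.
    rewrite ei mulnK // (bigD1 (Ordinal qm)) //= mulnC eqxx mulr1 big1 ?addr0 //.
    by move=> k kq; rewrite eqn_pmul2l // eq_sym (negPf kq : (k == q :> nat) = _) mulr0.
  rewrite big1 // => k _; case: eqP => [ei|_]; last by rewrite mulr0.
  by rewrite ei dvdn_mulr in ndv.
have -> : forall i, (i <= m)%N ->
    (\prod_(j < n) dilate (w j) (f j)) i = (\prod_(j < n) trunc j)`_i.
- elim/big_rec2: _ => [i _|j p u _ IH i im]; first by rewrite coef1.
  rewrite coefsM coefM; apply: eq_bigr => k _.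
  have km := leq_trans (leq_ord k) im.
  by rewrite truncE // IH // (leq_trans (leq_subr _ _) im).
- rewrite /trunc bigA_distr_bigA coef_sum [RHS]big_mkcond; apply: eq_bigr => k _.
  rewrite big_split /= -rmorph_prod -expr_sum coefCM coefXn eq_sym.
  by case: eqP; rewrite ?mulr1 ?mulr0.
- exact: leqnn.
Qed.

Lemma dilate1 u : dilate 1 u = u.
Proof. by apply/funext => n; rewrite /dilate dvd1n divn1. Qed.

(** * Rescaling the variable and the Euler derivation *)

Definition scaleS c u : series F := fun n => c ^+ n * u n.

Lemma scaleSM c u v : scaleS c (u * v) = scaleS c u * scaleS c v.
Proof.
apply/funext => n; rewrite /scaleS !coefsM mulr_sumr; apply: eq_bigr => i _.
by rewrite mulrACA -exprD subnKC // -ltnS.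
Qed.

Lemma scaleSD c u v : scaleS c (u + v) = scaleS c u + scaleS c v.
Proof. by apply/funext => n; rewrite coefsD -mulrDr. Qed.

Lemma scaleSN c u : scaleS c (- u) = - scaleS c u.
Proof. by apply/funext => n; rewrite coefsN -mulrN. Qed.

Lemma scaleS1 c : scaleS c 1 = 1.
Proof.
by apply/funext => -[|n]; rewrite /scaleS !coefs1 ?mulr1 ?mulr0.
Qed.

Lemma scaleS_var c : scaleS c varS = constS c * varS.
Proof.
by apply/funext => -[|[|n]]; rewrite coefs_constM /scaleS ?mulr0 ?expr1.
Qed.

Lemma scaleS_prod c (I : Type) (r : seq I) (P : pred I) (f : I -> series F) :
  scaleS c (\prod_(i <- r | P i) f i) = \prod_(i <- r | P i) scaleS c (f i).
Proof. by apply: (big_morph _ (@scaleSM c) (@scaleS1 c)). Qed.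

(** The operator z d/dz. *)
Definition euler u : series F := fun n => n%:R * u n.

Lemma eulerM u v : euler (u * v) = euler u * v + u * euler v.
Proof.
apply/funext => n; rewrite coefsD /euler !coefsM -big_split mulr_sumr /=.
apply: eq_bigr => i _; have -> : n%:R = i%:R + (n - i)%:R :> F.
  by rewrite -natrD subnKC // -ltnS.
by ring.
Qed.

Lemma euler1 : euler 1 = 0.
Proof. by apply/funext => -[|n]; rewrite /euler coefs1 ?mul0r ?mulr0. Qed.

Lemma eulerD u v : euler (u + v) = euler u + euler v.
Proof. by apply/funext => n; rewrite coefsD -mulrDr. Qed.

Lemma eulerN u : euler (- u) = - euler u.
Proof. by apply/funext => n; rewrite coefsN -mulrN. Qed.

Lemma euler_var : euler varS = varS.
Proof. by apply/funext => -[|[|n]]; rewrite /euler ?mul0r ?mul1r ?mulr0. Qed.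

Lemma euler_scale c u : euler (scaleS c u) = scaleS c (euler u).
Proof. by apply/funext => n; rewrite /euler /scaleS mulrCA. Qed.

Lemma eulerX u n : euler (u ^+ n.+1) = n.+1%:R * u ^+ n * euler u.
Proof.
elim: n => [|n IH]; first by rewrite expr1 !mul1r.
by rewrite exprS eulerM IH [n.+2%:R]mulrSr exprS; ring.
Qed.

(** Logarithmic derivatives add up along a product. *)
Lemma euler_prod (I : Type) (r : seq I) (P : pred I) (f g : I -> series F) :
  (forall i, P i -> euler (f i) = g i * f i) ->
  euler (\prod_(i <- r | P i) f i) =
    (\sum_(i <- r | P i) g i) * \prod_(i <- r | P i) f i.
Proof.
move=> fg; elim/big_rec2: _ => [|i s p Pi IH]; first by rewrite euler1 mul0r.
by rewrite eulerM IH fg //; ring.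
Qed.

End SeriesCoef.

Arguments varS {F}.

(** * Exponential and Bernoulli series *)

Section Bernoulli.
Variable F : numFieldType.
Implicit Types (c d : F) (m n t : nat).

Lemma fact_neq0 n : n`!%:R != 0 :> F.
Proof. by rewrite pnatr_eq0 -lt0n fact_gt0. Qed.

Definition expS c : series F := fun n => c ^+ n / n`!%:R.

Lemma expSD c d : expS (c + d) = expS c * expS d.
Proof.
apply/funext => n; rewrite mulrC coefsM /expS exprDn_comm; last exact: mulrC.
rewrite mulr_suml; apply: eq_bigr => i _.
have i_n : (i <= n)%N by rewrite -ltnS.
have := fact_neq0 i; have := fact_neq0 (n - i); have := fact_neq0 n.
rewrite -(bin_fact i_n) !natrM -mulr_natr mul1r mulf_eq0 => /norP[n0 _] ni0 i0.
by field; rewrite ni0 i0 n0.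
Qed.

Lemma expS0 : expS 0 = 1.
Proof. by apply/funext => -[|n]; rewrite /expS ?expr0 ?divr1 // expr0n mul0r. Qed.

Lemma expS_inv c : expS (- c) * expS c = 1.
Proof. by rewrite -expSD addNr expS0. Qed.

Lemma expSMn c n : expS (n%:R * c) = expS c ^+ n.
Proof.
elim: n => [|n IH]; first by rewrite mul0r expS0.
by rewrite mulrSr mulrDl mul1r expSD IH exprSr.
Qed.

Lemma expS_nat n : expS n%:R = expS 1 ^+ n.
Proof. by rewrite -expSMn mulr1. Qed.

Lemma expS_sum (I : Type) (r : seq I) (P : pred I) (f : I -> F) :
  expS (\sum_(i <- r | P i) f i) = \prod_(i <- r | P i) expS (f i).
Proof. by apply: (big_morph _ expSD expS0). Qed.

Lemma scale_expS c d : scaleS c (expS d) = expS (c * d).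
Proof. by apply/funext => n; rewrite /scaleS /expS exprMn mulrA. Qed.

Lemma euler_expS c : euler (expS c) = constS c * varS * expS c.
Proof.
apply/funext => -[|n]; rewrite -mulrA coefs_constM coefs_varM /euler /expS.
  by rewrite mul0r mulr0.
have := fact_neq0 n; have : n.+1%:R != 0 :> F by rewrite pnatr_eq0.
by rewrite factS natrM exprS; move: (n.+1%:R) => x x0 nf; field; rewrite nf x0.
Qed.

(** Comparing coefficients in z u' = h u gives k u_k = h_1 u_(k-1) + ... + h_k u_0,
    when h_0 = 0, which determines u_k from u_0 and h_1, ..., h_k. *)
Lemma euler_unique (h g u v : series F) m :
  euler u = h * u -> euler v = g * v -> u 0%N = v 0%N ->
  h 0%N = 0 -> g 0%N = 0 -> (forall k, (k <= m)%N -> h k = g k) -> u m = v m.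
Proof.
move=> hu gv uv0 h0 g0 hg; have [N] := ubnP m.
elim: N m hg => // N IH [|m] hg mN //.
have m0 : m.+1%:R != 0 :> F by rewrite pnatr_eq0.
apply: (mulfI m0); rewrite -[LHS]/(euler u m.+1) -[RHS]/(euler v m.+1) hu gv.
rewrite !coefsM [LHS]big_ord_recl [RHS]big_ord_recl h0 g0 !mul0r; congr (_ + _).
apply: eq_bigr => k _; rewrite hg ?ltn_ord // IH //; last by rewrite lift0; lia.
by move=> i im; apply: hg; rewrite (leq_trans im) // leq_subr.
Qed.

Lemma euler_dilate_expS w c : (0 < w)%N ->
  euler (dilate w (expS c)) = constS (w%:R * c) * varS ^+ w * dilate w (expS c).
Proof.
move=> w_gt0; apply/funext => i; rewrite -mulrA coefs_constM coefs_varXM.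
rewrite /euler /dilate; case: (boolP (w %| i)%N) => [/dvdnP[q ->]|ndv].
  case: q => [|q]; first by rewrite mul0n mul0r leqNgt w_gt0 mulr0.
  rewrite leq_pmull // mulSn addKn dvdn_mull // -mulSn !mulnK // /expS.
  have := fact_neq0 q; have : q.+1%:R != 0 :> F by rewrite pnatr_eq0.
  rewrite factS !natrM exprS; move: (q.+1%:R) => x x0 q0.
  by field; rewrite q0 x0.
case: leqP => wi; last by rewrite !mulr0.
by rewrite dvdn_subl // (negPf ndv) !mulr0.
Qed.

Variables (B : nat -> F) (B_bernoulli : is_bernoulli_seq B).

(** The expansion of c z / (exp (c z) - 1), which is 1 for c = 0. *)
Definition bernS c : series F := scaleS c (fun n => B n / n`!%:R).

Lemma bernS_expS c : bernS c * (expS c - 1) = constS c * varS.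
Proof.
pose b : series F := fun n => B n / n`!%:R.
have e : b * (expS 1 - 1) = varS.
  apply/funext => n; rewrite -[RHS]B_bernoulli coefsM; apply: eq_bigr => k _.
  by rewrite coefsB coefs1 /expS expr1n mul1r.
by rewrite /bernS -/b -scaleS_var -e scaleSM scaleSD scaleSN scaleS1 scale_expS mulr1.
Qed.

Lemma bernS0 c : bernS c 0%N = 1.
Proof.
have := B_bernoulli 1%N.
rewrite /series_mul big_ord_recr big_ord1 /= subnn exp_series_sub1_0 mulr0 addr0.
by rewrite exp_series_sub1_1 mulr1 /bernS /scaleS expr0 mul1r.
Qed.

Lemma bernoulli1 : B 1%N = - 2%:R^-1.
Proof.
have := B_bernoulli 2; rewrite /series_mul !big_ord_recr big_ord0 /=.
have := bernS0 1; rewrite /bernS /scaleS expr0 mul1r => ->.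
rewrite exp_series_sub1_0 exp_series_sub1_1 /exp_series_sub1 /= => h.
have {h} : 2%:R^-1 + B 1%N = 0 by rewrite -[RHS]h divr1; ring.
by move/eqP; rewrite addrC addr_eq0 => /eqP.
Qed.

(** Differentiating b(z) (exp z - 1) = z and multiplying by b(z) once more
    eliminates the exponential and leaves a Riccati equation for b. *)
Lemma euler_bernS c :
  euler (bernS c) = (1 - constS c * varS - bernS c) * bernS c.
Proof.
have h1 := bernS_expS 1; rewrite constS1 mul1r in h1.
have e1 : euler (bernS 1) = (1 - varS - bernS 1) * bernS 1.
  have h2 := congr1 (fun u => bernS 1 * euler u) h1; move: h2.
  rewrite /= eulerM eulerD eulerN euler1 subr0 euler_expS euler_var constS1 mul1r.
  have -> : bernS 1 * (euler (bernS 1) * (expS 1 - 1) + bernS 1 * (varS * expS 1))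
    = (bernS 1 * (expS 1 - 1)) * euler (bernS 1)
      + bernS 1 * varS * (bernS 1 * (expS 1 - 1) + bernS 1) by ring.
  rewrite h1 => h2; apply: varS_inj; move/(canRL (addrK _)): h2 => ->; ring.
(* The general case follows by rescaling the variable. *)
have -> : bernS c = scaleS c (bernS 1).
  by apply/funext => n; rewrite /bernS /scaleS expr1n mul1r.
rewrite euler_scale e1 scaleSM !(scaleSD, scaleSN) scaleS1.
by rewrite scaleS_var.
Qed.

(** * The residue identity *)

(** This is z w for w = 1 / (1 - exp (- z)). *)
Let todd := bernS (-1).

Lemma toddE : todd * (1 - expS (-1)) = varS.
Proof.
have := bernS_expS (-1); rewrite -/todd => h.
suff -> : varS = - (constS (-1) * varS) :> series F by rewrite -h; ring.
by apply/funext => n; rewrite coefsN coefs_constM mulN1r opprK.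
Qed.

Lemma todd_euler : euler todd = (1 + varS - todd) * todd.
Proof.
rewrite euler_bernS; congr ((_ - _) * _); congr (_ + _).
by apply/funext => n; rewrite coefsN coefs_constM mulN1r opprK.
Qed.

(** This is the residue of w ^ (m + 1), which does not depend on m: since
    w' = w - w ^ 2, the difference of consecutive powers of w is a derivative. *)
Lemma coef_todd m : (todd ^+ m.+1) m = 1.
Proof.
elim: m => [|m IH]; first by rewrite expr1 /todd bernS0.
have := congr1 (fun u : series F => u m.+1) (eulerX todd m).
rewrite todd_euler.
have -> : m.+1%:R * todd ^+ m * ((1 + varS - todd) * todd) =
   (todd ^+ m.+1 + varS * todd ^+ m.+1 - todd ^+ m.+2) *+ m.+1.
  by rewrite -mulr_natr !exprS; ring.
rewrite coefsMn coefsB coefsD coefs_varM IH /euler -[RHS]mulr_natl.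
have m0 : m.+1%:R != 0 :> F by rewrite pnatr_eq0.
by move/(mulfI m0); rewrite -addrA -[LHS]addr0 => /addrI/esym/subr0_eq.
Qed.

Definition ones : series F := fun=> 1.

Lemma onesE : (1 - varS) * ones = 1.
Proof.
by apply/funext => -[|n]; rewrite mulrBl mul1r coefsB coefs_varM ?subr0 ?subrr.
Qed.

(** The residue of exp (t z) w ^ (m + 1), as a function of t, is the coefficient
    of z ^ t in 1 / (1 - z) ^ (m + 1): both are multiplied by 1 - z when m
    decreases, and the residue identity gives the value at t = 0. *)
Lemma coef_exp_todd m t : (expS t%:R * todd ^+ m.+1) m = (ones ^+ m.+1) t.
Proof.
pose h m : series F := fun t => (expS t%:R * todd ^+ m.+1) m.
suff hE : h m = ones ^+ m.+1 by rewrite -hE.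
elim: m => [|m IH].
  by apply/funext => n; rewrite /h coefsM0 !expr1 /todd bernS0 /expS expr0 divr1 mulr1.
suff -> : h m.+1 = ones * h m by rewrite IH -exprS.
rewrite -[LHS]mul1r -onesE mulrAC mulrC; congr (_ * _); apply/funext => n.
rewrite mulrBl mul1r coefsB coefs_varM; case: n => [|n].
  by rewrite subr0 /h expS0 !mul1r !coef_todd.
rewrite /h -coefsB -natr1 expSD.
have e : expS 1 - 1 = expS 1 * (1 - expS (-1)).
  by rewrite mulrBr mulr1 [_ * expS (-1)]mulrC expS_inv.
have -> : expS n%:R * expS 1 * todd ^+ m.+2 - expS n%:R * todd ^+ m.+2
  = (expS 1 - 1) * expS n%:R * todd ^+ m.+2 by ring.
have -> : (expS 1 - 1) * expS n%:R * todd ^+ m.+2 =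
   varS * (expS n%:R * expS 1 * todd ^+ m.+1) by rewrite e -toddE !exprS; ring.
by rewrite coefs_varM.
Qed.

(** The left factor is z / (1 - exp (- c z)), and the geometric sum is
    (exp (c z) - 1) / (exp z - 1), which is exp ((c - 1) z) times
    (1 - exp (- c z)) / (1 - exp (- z)). *)
Lemma bernS_geometric (c : nat) : (0 < c)%N ->
  constS c%:R^-1 * bernS (- c%:R) * (\sum_(i < c) expS i%:R) =
    expS (c.-1)%:R * todd.
Proof.
move=> c_gt0; have c0 : c%:R != 0 :> F by rewrite pnatr_eq0 -lt0n.
have h := bernS_expS (- c%:R).
apply: varS_inj; rewrite -[in LHS]toddE.
have hs : (expS 1 - 1) * (\sum_(i < c) expS i%:R) = expS c%:R - 1.
  by rewrite [in RHS]expS_nat subrX1; congr (_ * _); apply: eq_bigr => i _;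
    rewrite expS_nat.
have e1 : 1 - expS (-1) = expS (-1) * (expS 1 - 1) by rewrite mulrBr expS_inv mulr1.
have ec : expS c%:R - 1 = - expS c%:R * (expS (- c%:R) - 1).
  by rewrite mulrBr mulrC mulrN expS_inv mulr1; ring.
have ep : expS (-1) * expS c%:R = expS (c.-1)%:R.
  by rewrite -expSD -[in LHS](prednK c_gt0) -natr1 addrCA addNr addr0.
transitivity (constS c%:R^-1 * bernS (- c%:R) * todd * expS (-1) *
    ((expS 1 - 1) * (\sum_(i < c) expS i%:R))); first by rewrite e1; ring.
rewrite hs ec -ep.
transitivity (- (constS c%:R^-1 * (bernS (- c%:R) * (expS (- c%:R) - 1)) *
    todd * expS (-1) * expS c%:R)); first by ring.
have -> : constS c%:R^-1 * (bernS (- c%:R) * (expS (- c%:R) - 1)) = - varS.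
  rewrite h mulrA -constSM mulrN mulVf //; apply/funext => n.
  by rewrite coefs_constM coefsN mulN1r.
by ring.
Qed.

End Bernoulli.

(** * Exponential polynomials *)

Section ExpPoly.
Variable C : numFieldType.
Implicit Types (l mu c : C) (p q : {poly C}) (f g : nat -> C) (L : seq C)
  (P : C -> {poly C}).

Definition exp_poly L P : nat -> C :=
  fun t => \sum_(l <- L) (P l).[t%:R] * l ^+ t.

Definition is_exp_poly L f := exists P, forall t, f t = exp_poly L P t.

(** The effect on p of the operator f(t + 1) - mu f(t) at f(t) = p(t) l ^ t. *)
Definition twist l mu p : {poly C} := l *: (p \Po ('X + 1)) - mu *: p.

Lemma exp_poly_twist L P mu t :
  exp_poly L P t.+1 - mu * exp_poly L P t =
    exp_poly L (fun l => twist l mu (P l)) t.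
Proof.
rewrite /exp_poly mulr_sumr -sumrB; apply: eq_bigr => l _.
rewrite /twist hornerD hornerN !hornerZ horner_comp !hornerE -natr1 exprS /=.
by ring.
Qed.

Lemma twistD l mu p q : twist l mu (p + q) = twist l mu p + twist l mu q.
Proof. by rewrite /twist comp_polyD !scalerDr opprD addrACA. Qed.

Lemma coef_twist l mu p k N : (size p <= N)%N ->
  (twist l mu p)`_k = l * (\sum_(i < N) p`_i * 'C(i, k)%:R) - mu * p`_k.
Proof.
move=> pN; rewrite /twist coefB !coefZ; congr (_ * _ - _).
rewrite coef_comp_poly (big_ord_widen N (fun i => p`_i * (('X + 1) ^+ i)`_k)) //.
rewrite big_mkcond; apply: eq_bigr => i _.
case: ltnP => [_|/(nth_default 0) ->]; last by rewrite mul0r.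
rewrite addrC exprDn coef_sum.
under eq_bigr => j _ do rewrite expr1n mul1r coefMn coefXn.
congr (_ * _); case: (ltnP k i.+1) => ki.
  rewrite (bigD1 (Ordinal ki)) //= eqxx big1 ?addr0 // => j.
  by rewrite -val_eqE /= eq_sym => /negPf ->; rewrite mul0rn.
rewrite bin_small // big1 // => j _.
by rewrite gtn_eqF ?mul0rn // (leq_ltn_trans _ ki) // -ltnS.
Qed.

Lemma coef_twist_top l mu p d : (size p <= d.+1)%N ->
  (twist l mu p)`_d = (l - mu) * p`_d.
Proof.
move=> pd; rewrite (coef_twist _ _ _ pd) big_ord_recr /= binn big1 ?add0r.
  by rewrite mulr1 mulrBl.
by move=> i _; rewrite bin_small ?mulr0.
Qed.

Lemma size_twist_le l mu p : (size (twist l mu p) <= size p)%N.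
Proof.
apply/leq_sizeP => j pj; rewrite coef_twist_top; last exact: leqW.
by rewrite nth_default ?mulr0.
Qed.

Lemma size_twist_lt l p : p != 0 -> (size (twist l l p) < size p)%N.
Proof.
move=> p0; case e : (size p) (size_twist_le l l p) => [|d] le_d.
  by rewrite -size_poly_eq0 e in p0.
rewrite ltnS; apply/leq_sizeP => j; rewrite leq_eqVlt => /orP[/eqP <-|dj].
  by rewrite coef_twist_top ?e // subrr mul0r.
by rewrite nth_default // (leq_trans le_d).
Qed.

Lemma twist_eq0 l mu p : l != mu -> twist l mu p = 0 -> p = 0.
Proof.
move=> lmu; case: (eqVneq p 0) => // p0 /(congr1 (fun q : {poly C} => q`_(size p).-1)).
rewrite coef_twist_top ?leqSpred // coef0 => /eqP.
by rewrite mulf_eq0 subr_eq0 (negPf lmu) -[p`__]/(lead_coef p) lead_coef_eq0 => /eqP.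
Qed.

(** The operator is onto, even when l = mu: the leading term is then matched
    by a monomial of one degree more. *)
Lemma twist_surj l mu q : l != 0 -> exists p, twist l mu p = q.
Proof.
move=> l0; move: {2}(size q) (leqnn (size q)) => N.
elim: N q => [|d IH] q.
  rewrite leqn0 size_poly_eq0 => /eqP ->.
  by exists 0; rewrite /twist comp_poly0 !scaler0 subrr.
move=> qd; suff [p0 [sp0 cp0]] : exists p0,
    (size (twist l mu p0) <= d.+1)%N /\ (twist l mu p0)`_d = q`_d.
  have [|p1 e1] := IH (q - twist l mu p0).
    apply/leq_sizeP => j; rewrite leq_eqVlt => /orP[/eqP <-|dj].
      by rewrite coefB cp0 subrr.
    by rewrite coefB !nth_default ?subrr // (leq_trans _ dj).
  by exists (p0 + p1); rewrite twistD e1 addrC subrK.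
case: (eqVneq l mu) => [<-|lmu].
  have d1 : d.+1%:R != 0 :> C by rewrite pnatr_eq0.
  pose c := q`_d / (l * d.+1%:R); exists (c *: 'X^(d.+1)).
  have sX : (size (c *: 'X^(d.+1) : {poly C}) <= d.+2)%N.
    by rewrite (leq_trans (size_scale_leq _ _)) // size_polyXn.
  split.
    case: (eqVneq (c *: 'X^(d.+1)) 0) => [->|X0].
      by rewrite (leq_trans (size_twist_le _ _ _)) // size_poly0.
    by rewrite -ltnS (leq_trans (size_twist_lt _ X0)).
  rewrite (coef_twist _ _ _ sX) big_ord_recr big_ord_recr /= big1.
    rewrite add0r binn binSn !coefZ !coefXn eqxx (ltn_eqF (leqnn _)) /c mulr0n mulr1n.
    by move: (d.+1%:R) d1 => x x0; field; rewrite x0 l0.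
  by move=> i _; rewrite bin_small ?mulr0.
have lmu' : l - mu != 0 by rewrite subr_eq0.
exists ((q`_d / (l - mu)) *: 'X^d).
have sX : (size ((q`_d / (l - mu)) *: 'X^d : {poly C}) <= d.+1)%N.
  by rewrite (leq_trans (size_scale_leq _ _)) // size_polyXn.
split; first exact: leq_trans (size_twist_le _ _ _) sX.
by rewrite coef_twist_top // coefZ coefXn eqxx mulr1 mulrC divfK.
Qed.

(** Solving the equation for each base l leaves a sequence h with
    h(t + 1) = mu h(t), which is a constant multiple of mu ^ t. *)
Lemma is_exp_poly_antidiff L f mu : uniq L -> 0 \notin L -> mu \in L ->
  is_exp_poly L (fun t => f t.+1 - mu * f t) -> is_exp_poly L f.
Proof.
move=> uL L0 muL [P fP].
have [R RP] : exists R, forall l, l != 0 -> twist l mu (R l) = P l.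
  suff /choice[R RP] : forall l, exists r, l != 0 -> twist l mu r = P l.
    by exists R.
  move=> l; case: (eqVneq l 0) => [->|l0]; first by exists 0.
  by have [r er] := twist_surj mu (P l) l0; exists r.
pose h t := f t - exp_poly L R t.
have hS t : h t.+1 = mu * h t.
  apply/eqP; rewrite -subr_eq0 /h; apply/eqP.
  transitivity ((f t.+1 - mu * f t) -
      (exp_poly L R t.+1 - mu * exp_poly L R t)); first by ring.
  rewrite fP exp_poly_twist; apply/eqP; rewrite subr_eq0; apply/eqP.
  rewrite /exp_poly; apply: eq_big_seq => l lL; rewrite RP //.
  by apply: contraNneq L0 => <-.
have hE t : h t = h 0%N * mu ^+ t.
  by elim: t => [|t IH]; rewrite ?mulr1 // hS IH exprS; ring.
exists (fun l => R l + (if l == mu then (h 0%N)%:P else 0)) => t.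
have -> : f t = exp_poly L R t + h t by rewrite /h addrC subrK.
rewrite hE /exp_poly; under [RHS]eq_bigr => l _ do rewrite hornerD mulrDl.
rewrite big_split /=; congr (_ + _).
rewrite (bigD1_seq mu) //= eqxx hornerC big1 ?addr0 // => l /negPf ->.
by rewrite horner0 mul0r.
Qed.

Lemma poly_eq0_nat p : (forall t : nat, p.[t%:R] = 0) -> p = 0.
Proof.
move=> p0; apply/(@roots_geq_poly_eq0 _ p [seq i%:R | i <- iota 0 (size p)]).
- by apply/allP => _ /mapP[i _ ->]; apply/rootP.
- by rewrite map_inj_uniq ?iota_uniq // => i j /eqP; rewrite eqr_nat => /eqP.
- by rewrite size_map size_iota.
Qed.

(** Uniqueness, by induction on the total size of the coefficients: applying
    f(t + 1) - l f(t) lowers the degree at l and keeps the other degrees. *)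
Lemma exp_poly_eq0 L P : uniq L -> 0 \notin L ->
  (forall t, exp_poly L P t = 0) -> forall l, l \in L -> P l = 0.
Proof.
move=> uL L0; have [N] := ubnPleq (\sum_(l <- L) size (P l))%N.
elim: N P => [|N IH] P PN fP l lL.
  apply/eqP; rewrite -size_poly_eq0 -leqn0 (leq_trans _ PN) //.
  by rewrite (bigD1_seq l) //= leq_addr.
apply/eqP/negPn/negP => Pl0; have l0 : l != 0 by apply: contraNneq L0 => <-.
have P0 : forall mu, mu \in L -> twist mu l (P mu) = 0.
  apply: (IH (fun mu => twist mu l (P mu))); last first.
    by move=> t; rewrite -exp_poly_twist !fP mulr0 subrr.
  rewrite -ltnS (leq_trans _ PN) // (bigD1_seq l) //= [X in (_ < X)%N](bigD1_seq l) //=.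
  rewrite -addSn leq_add ?size_twist_lt //.
  by apply: leq_sum => mu _; apply: size_twist_le.
have Q0 mu : mu \in L -> mu != l -> P mu = 0.
  by move=> muL mul; apply: (twist_eq0 mul); apply: P0.
case/eqP: Pl0; apply: poly_eq0_nat => t.
have /eqP := fP t; rewrite /exp_poly (bigD1_seq l) //= big_seq_cond big1 ?addr0.
  by rewrite mulf_eq0 expf_eq0 (negPf l0) andbF orbF => /eqP.
by move=> mu /andP[muL mul]; rewrite Q0 // horner0 mul0r.
Qed.

Definition window (a : nat) f : nat -> C := fun t => \sum_(i < a) f (t + i)%N.

Lemma is_exp_poly_roots L f r : uniq L -> 0 \notin L -> {subset r <= L} ->
  is_exp_poly L (fun t => \sum_(i < (size r).+1)
     (\prod_(mu <- r) ('X - mu%:P))`_i * f (t + i)%N) -> is_exp_poly L f.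
Proof.
move=> uL L0; elim: r f => [|mu r IH] f rL.
  case=> P fP; exists P => t.
  by rewrite -fP big_nil big_ord1 coef1 mul1r addn0.
move=> h; apply: (@is_exp_poly_antidiff _ _ mu) => //.
  by apply: rL; rewrite mem_head.
apply: IH => [x xr|]; first by apply: rL; rewrite inE xr orbT.
case: h => P fP; exists P => t; rewrite -fP /=.
rewrite big_cons; set w := \prod_(_ <- _) _.
have sw : (w)`_(size r).+1 = 0.
  by rewrite nth_default // /w size_prod_XsubC.
under [LHS]eq_bigr => i _ do rewrite mulrBr.
rewrite sumrB; under [RHS]eq_bigr => i _ do rewrite mulrBl coefB coefXM coefCM mulrBl.
rewrite sumrB; congr (_ - _).
  rewrite [RHS]big_ord_recl mul0r add0r; apply: eq_bigr => i _.
  by rewrite lift0 /= addnS.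
rewrite [RHS]big_ord_recr /= sw mulr0 mul0r addr0.
by apply: eq_bigr => i _; ring.
Qed.

End ExpPoly.

Section RootsOfUnity.
Variable C : numClosedFieldType.
Implicit Types (L : seq C) (f : nat -> C).

(** The window sum is the polynomial 1 + E + ... + E ^ (a - 1) in the shift E;
    its roots are the a-th roots of unity other than 1. *)
Lemma is_exp_poly_window L f a : (0 < a)%N -> uniq L -> 0 \notin L ->
  (forall mu, mu ^+ a = 1 -> mu != 1 -> mu \in L) ->
  is_exp_poly L (window a f) -> is_exp_poly L f.
Proof.
case: a => // a _ uL L0 rootsL [P fP].
pose q : {poly C} := \poly_(i < a.+1) 1.
have lq : lead_coef q = 1 by rewrite lead_coef_poly ?oner_eq0.
have [r er] := closed_field_poly_normal q; rewrite lq scale1r in er.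
have sr : size r = a.
  by have := congr1 (fun p : {poly C} => size p) er;
    rewrite size_prod_XsubC size_poly_eq ?oner_eq0 // => -[].
have qE mu : q.[mu] = \sum_(i < a.+1) mu ^+ i.
  by rewrite horner_poly; apply: eq_bigr => i _; rewrite mul1r.
apply: (@is_exp_poly_roots _ _ _ r) => //.
  move=> mu; rewrite -root_prod_XsubC -er => /rootP; rewrite qE => qmu.
  apply: rootsL; first by apply/eqP; rewrite -subr_eq0 subrX1 qmu mulr0.
  apply: contra_eq_neq qmu => ->.
  under eq_bigr => i _ do rewrite expr1n.
  by rewrite sumr_const card_ord pnatr_eq0.
exists P => t; rewrite -fP -er sr; apply: eq_bigr => i _.
by rewrite coef_poly ltn_ord mul1r.
Qed.

End RootsOfUnity.

(** * The polynomial part *)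

Section Partition.
Variable C : numClosedFieldType.
Implicit Types (u c : series C) (L : seq C).

Definition geom (a : nat) : series C := \sum_(i < a) varS ^+ i.

Lemma coef_geomM u a o t : (0 < a)%N ->
  (u * geom a) (t + (o + a.-1))%N = window a (fun t => u (t + o)%N) t.
Proof.
move=> a_gt0; rewrite mulrC /geom mulr_suml coefs_sum.
rewrite (reindex_inj rev_ord_inj); apply: eq_bigr => i _ /=.
have ia := ltn_ord i.
rewrite coefs_varXM ifT; last by lia.
by congr (u _); lia.
Qed.

(** Both sides are the inverse of 1 - z. *)
Lemma dilate_ones_geom a : (0 < a)%N -> dilate a (ones C) * geom a = ones C.
Proof.
move=> a_gt0.
have h : (1 - varS ^+ a) * dilate a (ones C) = 1.
  apply/funext => n; rewrite mulrBl mul1r coefsB coefs_varXM coefs1 /dilate.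
  case: leqP => an.
    by rewrite dvdn_subl ?dvdnn // subrr gtn_eqF // (leq_trans a_gt0).
  by rewrite subr0; case: n an => [|n] an; rewrite ?dvdn0 // gtnNdvd.
have hg : (1 - varS) * geom a = 1 - varS ^+ a.
  by rewrite -[RHS]opprB subrX1 -/(geom a); ring.
transitivity ((1 - varS) * ones C * (dilate a (ones C) * geom a)).
  by rewrite onesE mul1r.
transitivity (ones C * ((1 - varS) * geom a * dilate a (ones C))); first by ring.
by rewrite hg h mulr1.
Qed.

(** Summing over windows of lengths a_j multiplies, up to a shift, the series u
    by geometric sums, and multiplies c by geometric sums of exponentials.
    If the two results agree, undoing the window sums one after the other only
    adds exponential terms with bases in L. *)
Lemma is_exp_poly_residue (I : eqType) (r : seq I) (a : I -> nat) L u c k o :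
  uniq L -> 0 \notin L ->
  (forall j, (0 < a j)%N) ->
  (forall j mu, mu ^+ a j = 1 -> mu != 1 -> mu \in L) ->
  (forall t, (u * \prod_(j <- r) geom (a j)) (t + (o + \sum_(j <- r) (a j).-1))%N =
     (expS t%:R * (c * \prod_(j <- r) \sum_(i < a j) expS i%:R)) k) ->
  is_exp_poly L (fun t => u (t + o)%N - (expS t%:R * c) k).
Proof.
move=> uL L0 a_gt0 aL; elim: r u c o => [|j r IH] u c o.
  rewrite !big_nil => h; exists (fun=> 0) => t.
  have := h t; rewrite !mulr1 addn0 => ->; rewrite subrr.
  by rewrite /exp_poly big1 // => l _; rewrite horner0 mul0r.
move=> h; apply: (@is_exp_poly_window _ _ _ (a j)) => //; first exact: aL.
case: (IH (u * geom (a j)) (c * \sum_(i < a j) expS i%:R) (o + (a j).-1)%N).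
  by move=> t; have := h t; rewrite !big_cons -!mulrA -[(o + _ + _)%N]addnA.
move=> P hP; exists P => t; rewrite -hP coef_geomM // /window sumrB; congr (_ - _).
rewrite mulrA mulr_sumr coefs_sum; apply: eq_bigr => i _.
by rewrite natrD expSD mulrAC.
Qed.

Lemma restricted_partitionE n (a : 'I_n -> nat) t : (forall j, (0 < a j)%N) ->
  (restricted_partition a t)%:R = (\prod_(j < n) dilate (a j) (ones C)) t.
Proof.
move=> a_gt0; rewrite coefs_prod_dilate // /restricted_partition -sum1_card natr_sum.
apply: eq_big => [k|k _]; last by rewrite big1.
by apply: etrans (asboolb _) _; under eq_bigr => j _ do rewrite mulnC.
Qed.

Variables (n : nat) (a : 'I_n -> nat).
Hypotheses (n_gt0 : (0 < n)%N) (a_gt0 : forall j, (0 < a j)%N).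
Variables (B : nat -> C) (B_bernoulli : is_bernoulli_seq B).

(** The product of the 1 / (1 - exp (- a_j z)), multiplied by z ^ n. *)
Definition todd_prod : series C :=
  \prod_(j < n) (constS (a j)%:R^-1 * bernS B (- (a j)%:R)).

Lemma todd_prod_exp_poly L : uniq L -> 0 \notin L ->
  (forall j mu, mu ^+ a j = 1 -> mu != 1 -> mu \in L) ->
  is_exp_poly L
    (fun t => (restricted_partition a t)%:R - (expS t%:R * todd_prod) n.-1).
Proof.
move=> uL L0 aL; pose u := \prod_(j < n) dilate (a j) (ones C).
have [|P hP] := @is_exp_poly_residue _ (index_enum 'I_n) a L u todd_prod n.-1 0
  uL L0 a_gt0 aL.
  move=> t; rewrite -!big_split add0n /=.
  under eq_bigr => j _ do rewrite dilate_ones_geom //.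
  under [in RHS]eq_bigr => j _ do rewrite bernS_geometric //.
  rewrite big_split /= -expS_sum !prodr_const card_ord mulrA -expSD -natr_sum -natrD.
  have := coef_exp_todd B_bernoulli n.-1 (t + \sum_(j < n) (a j).-1).
  by rewrite prednK.
by exists P => t; rewrite -hP addn0 restricted_partitionE.
Qed.

Definition todd_poly : {poly C} := \poly_(i < n) (todd_prod (n.-1 - i)%N / i`!%:R).

Lemma horner_todd_poly t : todd_poly.[t] = (expS t * todd_prod) n.-1.
Proof.
rewrite horner_poly coefsM prednK //; apply: eq_bigr => i _.
by rewrite /expS; ring.
Qed.

(** The index set is 1 together with L1, the remaining roots of unity: putting
    Q at 1 next to an expansion of p_A - Q over L1 gives a decomposition. *)
Lemma polynomial_partE : polynomial_part C a = todd_poly.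
Proof.
have [r rE] := closed_field_poly_normal (\prod_(j < n) ('X^(a j) - 1 : {poly C})).
pose L1 := [seq l <- undup r | l != 1]; pose L := 1 :: L1.
have memr l : (l \in r) = [exists j, l ^+ a j == 1].
  have P0 : \prod_(j < n) ('X^(a j) - 1 : {poly C}) != 0.
    by apply/prodf_neq0 => j _; rewrite monic_neq0 // monicXnsubC.
  have lc : lead_coef (\prod_(j < n) ('X^(a j) - 1 : {poly C})) != 0.
    by rewrite lead_coef_eq0.
  rewrite -root_prod_XsubC -(rootZ _ _ lc) -rE rootE horner_prod.
  have hE j : ('X^(a j) - 1 : {poly C}).[l] = l ^+ a j - 1.
    by rewrite hornerD hornerN hornerXn hornerC.
  apply/prodf_eq0/existsP => [[j _]|[j lj]]; last exists j => //.
    by rewrite hE subr_eq0; exists j.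
  by rewrite hE subr_eq0.
have uL1 : uniq L1 by rewrite filter_uniq // undup_uniq.
have uL : uniq L by rewrite /L /= uL1 mem_filter eqxx.
have L0 : 0 \notin L.
  rewrite inE eq_sym oner_eq0 mem_filter mem_undup memr negb_and; apply/orP; right.
  by apply/existsPn => j; rewrite expr0n eqn0Ngt a_gt0 eq_sym oner_eq0.
have L10 : 0 \notin L1 by move: L0; rewrite inE => /norP[].
have L1a j mu : mu ^+ a j = 1 -> mu != 1 -> mu \in L1.
  move=> e mu1; rewrite mem_filter mu1 mem_undup memr.
  by apply/existsP; exists j; apply/eqP.
have LE : [set l : C | exists i, l ^+ a i = 1]%classic = [set` L]%classic.
  apply/seteqP; split => l /=.
    by case=> j lj; rewrite inE; case: eqVneq => //= l1; apply: (L1a j).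
  rewrite inE => /orP[/eqP ->|]; first by exists (Ordinal n_gt0); rewrite expr1n.
  rewrite mem_filter mem_undup memr => /andP[_ /existsP[j /eqP lj]].
  by exists j.
have decE P : is_partition_decomposition a P <->
    forall t, (restricted_partition a t)%:R = exp_poly L P t.
  have fsE t : exp_poly L P t = \sum_(l \in [set` L]) (P l).[t%:R] * l ^+ t.
    exact: fsbig_seq.
  rewrite /is_partition_decomposition LE.
  by split=> h t; [rewrite fsE; apply: h | rewrite -fsE; apply: h].
have [P hP] := todd_prod_exp_poly uL1 L10 L1a.
pose P' l := if l == 1 then todd_poly else P l.
have dP' : is_partition_decomposition a P'.
  apply/decE => t; rewrite /exp_poly big_cons /P' eqxx expr1n mulr1.
  have -> : \sum_(l <- L1) (if l == 1 then todd_poly else P l).[t%:R] * l ^+ t =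
      exp_poly L1 P t.
    apply: eq_big_seq => l; rewrite mem_filter => /andP[/negPf -> _] //.
  by rewrite -hP horner_todd_poly addrC subrK.
apply: xget_unique; first by exists P'; split=> //; rewrite /P' eqxx.
move=> Q [P'' [/decE dP'' <-]].
have := @exp_poly_eq0 _ L (fun l => P'' l - P' l) uL L0.
move=> /(_ _ 1); rewrite mem_head {2}/P' eqxx => h.
apply/eqP; rewrite -subr_eq0 h // => t.
have /decE d := dP'; have := d t; rewrite dP'' => /eqP; rewrite -subr_eq0 => /eqP <-.
rewrite /exp_poly -sumrB; apply: eq_bigr => l _.
by rewrite hornerD hornerN mulrBl.
Qed.

(** * The two expressions of the coefficients *)

Definition bern_prod : series C := \prod_(j < n) bernS B (a j)%:R.

Lemma todd_prodE m :
  todd_prod m = (\prod_(j < n) (a j)%:R)^-1 * ((-1) ^+ m * bern_prod m).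
Proof.
rewrite /todd_prod big_split /= -constS_prod coefs_constM prodfV; congr (_ * _).
have -> : \prod_(j < n) bernS B (- (a j)%:R) = scaleS (-1) bern_prod.
  rewrite scaleS_prod; apply: eq_bigr => j _; apply/funext => i.
  by rewrite /bernS /scaleS -mulN1r exprMn -mulrA.
by [].
Qed.

Lemma horner_polynomial_part t : (polynomial_part C a).[t] =
  (\prod_(j < n) (a j)%:R)^-1 *
  \sum_(m < n) (-1) ^+ m / (n - 1 - m)`!%:R * bern_prod m * t ^+ (n - 1 - m).
Proof.
rewrite polynomial_partE horner_todd_poly mulrC coefsM prednK // mulr_sumr.
by apply: eq_bigr => m _; rewrite todd_prodE subn1 /expS; ring.
Qed.

Lemma bern_prodE m : bern_prod m =
  \sum_(k : {ffun 'I_n -> 'I_m.+1} | (\sum_(j < n) k j)%N == m)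
    (\prod_(j < n) (a j)%:R ^+ k j) *
      ((\prod_(j < n) B (k j)) / \prod_(j < n) (k j)`!%:R).
Proof.
rewrite /bern_prod; under eq_bigr => j _ do rewrite -[bernS _ _]dilate1.
rewrite coefs_prod_dilate //; apply: eq_big => [k|k _].
  by under eq_bigr => j _ do rewrite mul1n.
by rewrite -prodf_div -big_split.
Qed.

(** The coefficient of z ^ (i + 1) in the logarithm of the product of
    Bernoulli series. *)
Definition log_coef (i : nat) : C :=
  (-1) ^+ (2 <= i.+1)%N *
    (B i.+1 * (power_sum a i.+1)%:R / (i.+1%:R * (i.+1)`!%:R)).

(** The product of Bernoulli series is the exponential of its logarithm;
    expanding the exponentials of the single terms gives the sum over k. *)
Lemma bern_prod_logE m : bern_prod m =
  \sum_(k : {ffun 'I_m -> 'I_m.+1} | (\sum_(i < m) i.+1 * k i)%N == m)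
    \prod_(i < m) (log_coef i ^+ k i / (k i)`!%:R).
Proof.
transitivity ((\prod_(i < m) dilate i.+1 (expS (log_coef i))) m); last first.
  exact: coefs_prod_dilate.
apply: (@euler_unique _
  (\sum_(j < n) (1 - constS (a j)%:R * varS - bernS B (a j)%:R))
  (\sum_(i < m) constS (i.+1%:R * log_coef i) * varS ^+ i.+1)).
- by apply: euler_prod => j _; apply: euler_bernS.
- by apply: euler_prod => i _; apply: euler_dilate_expS.
- rewrite /bern_prod !coefs_prod0 !big1 // => i _; last exact: bernS0.
  by rewrite /dilate dvdn0 div0n /expS expr0 divr1.
- rewrite coefs_sum big1 // => j _.
  by rewrite !coefsB coefs_constM bernS0 // coefs1 mulr0 subr0 subrr.
- rewrite coefs_sum big1 // => i _.
  by rewrite coefs_constM -[_ ^+ _]mulr1 coefs_varXM mulr0.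
move=> k; rewrite !coefs_sum; case: k => [_|k km].
  rewrite !big1 // => i _.
    by rewrite coefs_constM -[_ ^+ _]mulr1 coefs_varXM mulr0.
  by rewrite !coefsB coefs_constM bernS0 // coefs1 mulr0 subr0 subrr.
rewrite [RHS](bigD1 (Ordinal km)) //= [X in _ = _ + X]big1 ?addr0; last first.
  move=> i /negPf ik; rewrite coefs_constM -[_ ^+ _]mulr1 coefs_varXM coefs1.
  case: leqP => ik'; first by rewrite mulr0.
  case: eqP => [e|_]; last exact: mulr0.
  have ek : i = k :> nat.
    by apply/eqP; rewrite eqn_leq -ltnS ik' -subn_eq0 -subSS e eqxx.
  by rewrite -val_eqE /= ek eqxx in ik.
rewrite coefs_constM -[_ ^+ _]mulr1 coefs_varXM leqnn subnn coefs1 eqxx mulr1.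
have k0 : k.+1%:R != 0 :> C by rewrite pnatr_eq0.
under eq_bigr => j _ do rewrite !coefsB coefs1 sub0r coefs_constM.
have f0 := fact_neq0 C k.+1.
rewrite sumrB sumrN /log_coef /power_sum natr_sum.
rewrite /bernS /scaleS -!mulr_suml.
under [X in _ = _ * (_ * (_ * X / _))]eq_bigr => j _ do rewrite natrX.
(* The linear coefficient is special: there the term - a_j z contributes, and
   B_1 = - 1/2 turns - s_1 - B_1 s_1 into B_1 s_1, whence the exceptional sign. *)
case: k km k0 f0 => [|k] km k0 f0; rewrite /varS /= ?eqxx.
  under [X in _ - X * _]eq_bigr => j _ do rewrite expr1.
  by under [X in _ * (_ * (_ * X / _))]eq_bigr => j _ do rewrite expr1;
    rewrite (bernoulli1 B_bernoulli) expr0 factS fact0; field.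
rewrite mulr0 oppr0 sub0r expr1.
move: ((k.+2)`!%:R : C) f0 => y f0; move: (k.+2%:R : C) k0 => x x0.
by field; rewrite x0 f0.
Qed.

Lemma bern_prod_powersumE m : bern_prod m =
  \sum_(k : {ffun 'I_m -> 'I_m.+1} | (\sum_(i < m) i.+1 * k i)%N == m)
    (-1) ^+ (\sum_(i < m | (2 <= i.+1)%N) k i)%N /
      (\prod_(i < m) (k i)`!%:R) *
    \prod_(i < m)
      (B i.+1 * (power_sum a i.+1)%:R / (i.+1%:R * (i.+1)`!%:R)) ^+ k i.
Proof.
rewrite bern_prod_logE; apply: eq_bigr => k _.
rewrite prodf_div mulrAC; congr (_ / _).
rewrite expr_sum [X in X * _]big_mkcond -big_split; apply: eq_bigr => i _.
by rewrite /log_coef exprMn; case: leqP => _; rewrite ?expr1n ?expr0.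
Qed.

End Partition.

Theorem mainTheorem1 (R : realType) (n : nat) (a : 'I_n -> nat)
    (n_gt0 : (0 < n)%N) (a_inj : injective a)
    (a_gt0 : forall j : 'I_n, (0 < a j)%N)
    (B : nat -> complex R) (B_bernoulli : is_bernoulli_seq B)
    (t : complex R) :
  (polynomial_part (complex R) a).[t] =
    (\prod_(j < n) (a j)%:R)^-1 *
    \sum_(m < n)
      (-1) ^+ m / (n - 1 - m)`!%:R *
      (\sum_(k : {ffun 'I_n -> 'I_m.+1} | (\sum_(j < n) k j)%N == m)
        (\prod_(j < n) (a j)%:R ^+ k j) *
        ((\prod_(j < n) B (k j)) / \prod_(j < n) (k j)`!%:R)) *
      t ^+ (n - 1 - m)
  /\
  (polynomial_part (complex R) a).[t] =
    (\prod_(j < n) (a j)%:R)^-1 *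
    \sum_(m < n)
      (-1) ^+ m / (n - 1 - m)`!%:R *
      (* i : 'I_m stands for the index i + 1 in 1..m *)
      (\sum_(k : {ffun 'I_m -> 'I_m.+1} | (\sum_(i < m) i.+1 * k i)%N == m)
        (-1) ^+ (\sum_(i < m | (2 <= i.+1)%N) k i)%N /
          (\prod_(i < m) (k i)`!%:R) *
        \prod_(i < m)
          (B i.+1 * (power_sum a i.+1)%:R / (i.+1%:R * (i.+1)`!%:R)) ^+ k i) *
      t ^+ (n - 1 - m).
Proof.
split; rewrite (horner_polynomial_part n_gt0 a_gt0 B_bernoulli).
  by congr (_ * _); apply: eq_bigr => m _; rewrite bern_prodE.
by congr (_ * _); apply: eq_bigr => m _; rewrite (bern_prod_powersumE a B_bernoulli).
Qed.
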